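(* Let $H = F^2(\mathbb{R}^n)$ be the real valued Bargmann-Fock space, i.e. the reproducing kernel Hilbert space over $\mathbb{R}^n$ with kernel $K(x,y) = \exp(x^T y)$, and let $a \in \mathbb{R}$ with $|a| < 1$. Let $f : \mathbb{R}^n \to \mathbb{R}^n$ be such that the scaled Liouville operator $A_{f,a}$ is a compact operator on $H$. Suppose that $\{\gamma_i : [0,T_i] \to \mathbb{R}^n\}_{i=1}^\infty$ is a sequence of trajectories satisfying $\dot\gamma_i = f(\gamma_i)$, with corresponding occupation kernels $\Gamma_{\gamma_i} \in H$. For each $M$ let $\alpha_M = \{\Gamma_{\gamma_1}, \ldots, \Gamma_{\gamma_M}\}$ and let $P_{\alpha_M}$ be the orthogonal projection of $H$ onto $\operatorname{span}(\alpha_M)$. If the collection of functions $\{\Gamma_{\gamma_i}\}_{i=1}^\infty$ is dense in $H$, then the sequence of operators $\{P_{\alpha_M} A_{f,a} P_{\alpha_M}\}_{M=1}^\infty$ converges to $A_{f,a}$ in the operator norm topology as $M \to \infty$.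
   Context: A reproducing kernel Hilbert space (RKHS) over $\mathbb{R}^n$ is a Hilbert space $H$ of functions $\mathbb{R}^n \to \mathbb{R}$ for which every point evaluation is bounded; its kernel is $K(x,y) = \langle k_y, k_x\rangle_H$, where $k_x \in H$ represents evaluation at $x$. For an RKHS $H$ over $\mathbb{R}^n$, $a \in \mathbb{R}$ with $|a|<1$, and $f : \mathbb{R}^n \to \mathbb{R}^n$, the scaled Liouville operator with symbol $f$ is $A_{f,a} : \mathcal{D}(A_{f,a}) \to H$ given by $A_{f,a} g(x) = a \nabla g(ax) f(x)$ for all $x \in \mathbb{R}^n$ (with $\nabla g$ regarded as a row vector), with domain $$\mathcal{D}(A_{f,a}) = \{ h \in H : \text{the function } x \mapsto a \nabla h(ax) f(x) \text{ belongs to } H\}.$$ That $A_{f,a}$ is a compact operator on $H$ includes that it is defined on all of $H$. For an RKHS $H$ of continuous functions and an essentially bounded measurable $\gamma : [0,T] \to \mathbb{R}^n$, the occupation kernel of $\gamma$ in $H$ is the unique $\Gamma_\gamma \in H$ with $\langle g, \Gamma_\gamma\rangle_H = \int_0^T g(\gamma(t))\,dt$ for all $g \in H$. *)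

(* Defs.v *)
From HB Require Import structures.
From mathcomp Require Import all_boot all_order all_algebra.
From mathcomp Require Import all_classical all_reals all_analysis.

Set Implicit Arguments.
Unset Strict Implicit.
Unset Printing Implicit Defensive.

Import Order.TTheory GRing.Theory Num.Theory.
Import numFieldNormedType.Exports.

Local Open Scope classical_set_scope.
Local Open Scope ring_scope.

(* The elements of the space are functions on X through the injective linear
   map [ev]; the inner product is the real symmetric positive definite form
   [ip], and [norm_ip] says that it induces the (complete) norm. *)
Record rkhs (R : realType) (X : Type) := RKHS {
  space :> completeNormedModType R ;
  ip : {dot space for idfun} ;
  norm_ip : forall u : space, `|u| ^+ 2 = ip u u ;
  ev : space -> X -> R ;
  ev_linear : forall (c : R) (u v : space) (x : X),
    ev (c *: u + v) x = c * ev u x + ev v x ;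
  ev_inj : injective ev ;
  ev_bounded : forall x : X, exists C : R, forall u : space,
    `|ev u x| <= C * `|u|
}.

Arguments ip {R X} r.
Arguments ev {R X r}.

Definition has_kernel (R : realType) (X : Type) (H : rkhs R X)
    (K : X -> X -> R) : Prop :=
  exists k : X -> H,
    (forall (x : X) (h : H), ev h x = ip H h (k x)) /\
    (forall x y : X, K x y = ip H (k y) (k x)).

(* The kernel determines the space up to an isometry commuting with [ev], so
   this says that H is the real Bargmann-Fock space. *)
Definition is_bargmann_fock (R : realType) (n : nat) (H : rkhs R 'cV[R]_n)
    : Prop :=
  has_kernel H (fun x y : 'cV[R]_n => expR ((x^T *m y) 0 0)).

Definition gradient (R : realType) (n : nat) (g : 'cV[R]_n -> R)
    (y : 'cV[R]_n) : 'rV[R]_n :=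
  \row_(i < n) 'D_(delta_mx i 0) g y.

Definition liouville_fun (R : realType) (n : nat)
    (f : 'cV[R]_n -> 'cV[R]_n) (a : R) (g : 'cV[R]_n -> R) (x : 'cV[R]_n) : R :=
  a * (gradient g (a *: x) *m f x) 0 0.

(* Differentiability is demanded because the library's 'D is total: without it
   [gradient] could be a junk value. *)
Definition liouville_dom (R : realType) (n : nat) (H : rkhs R 'cV[R]_n)
    (f : 'cV[R]_n -> 'cV[R]_n) (a : R) : set H :=
  [set h | (forall x : 'cV[R]_n, differentiable (ev h) (a *: x)) /\
           exists u : H, ev u = liouville_fun f a (ev h)].

(* Meaningful on [liouville_dom H f a] only; 0 where no such u exists. *)
Definition liouville (R : realType) (n : nat) (H : rkhs R 'cV[R]_n)
    (f : 'cV[R]_n -> 'cV[R]_n) (a : R) (h : H) : H :=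
  xget 0 [set u : H | ev u = liouville_fun f a (ev h)].

Arguments liouville_dom {R n} H f a.
Arguments liouville {R n} H f a h.

(* D is the domain of the operator A. *)
Definition compact_operator (R : realType) (V : normedModType R) (D : set V)
    (A : V -> V) : Prop :=
  [/\ D = setT, linear A &
      forall B : set V, bounded_set B -> precompact (A @` B)].

Definition trajectory (R : realType) (n : nat) (f : 'cV[R]_n -> 'cV[R]_n)
    (T : R) (gamma : R -> 'cV[R]_n) : Prop :=
  {within `[0, T], continuous gamma} /\
  (forall t : R, t \in `]0, T[ -> is_derive t 1 gamma (f (gamma t))).

Definition is_occupation_kernel (R : realType) (n : nat)
    (H : rkhs R 'cV[R]_n) (T : R) (gamma : R -> 'cV[R]_n) (G : H) : Prop :=
  forall g : H,
    ip H g G = \int[@lebesgue_measure R]_(t in `[0, T]) ev g (gamma t).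

(* Density of a family of occupation kernels in H means density of the union of
   these spans: the family itself is never dense when the constant 1 lies in H,
   since its inner product with an occupation kernel is T > 0. *)
Definition span_first (R : realType) (V : lmodType R) (G : nat -> V) (M : nat)
    : set V :=
  [set \sum_(i < M) c i *: G i | c in [set: nat -> R]].

(* The point p exists and is unique when W is a closed subspace, in particular
   when W is finite dimensional. *)
Definition orth_proj (R : realType) (X : Type) (H : rkhs R X) (W : set H)
    (h : H) : H :=
  xget 0 [set p : H | W p /\ forall w : H, W w -> ip H (h - p) w = 0].

(* Extended-real valued, so that an unbounded operator has norm +oo. *)
Definition op_norm (R : realType) (V : normedModType R) (A : V -> V) : \bar R :=
  ereal_sup [set `|A h|%:E | h in [set h : V | `|h| <= 1]].

(* Main.v *)
Require Import Defs.
From HB Require Import structures.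
From mathcomp Require Import all_boot all_order all_algebra.
From mathcomp Require Import all_classical all_reals all_analysis.
From mathcomp Require Import ring lra.

Set Implicit Arguments.
Unset Strict Implicit.
Unset Printing Implicit Defensive.

Import Order.TTheory GRing.Theory Num.Theory.
Import numFieldNormedType.Exports.

Local Open Scope classical_set_scope.
Local Open Scope ring_scope.

(** Only the Hilbert space structure and the compactness of the operator [A]
matter. A bounded functional [phi] is uniformly small on the unit ball of the
orthogonal complement of [V M], for [M] large: this follows by almost minimising
[`|u| ^+ 2 - 2 * phi u] inside some [V M], with no appeal to the Riesz
representation. Applied to [phi g = <A g, y>] with [y] in the compact closure of
the image of the unit ball, and then to [y = A g], it gives [A (1 - P_M) --> 0]
in norm without the adjoint of [A]. On the same compact set [1 - P_M] tends to 0
uniformly, and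
[P_M A P_M - A = - (1 - P_M) A P_M - A (1 - P_M)]. *)

(** * Compact operators on a normed space *)

Lemma compact_operator_unit_ball (R : realType) (V : normedModType R)
    (D : set V) (A : V -> V) : compact_operator D A ->
  exists K : set V, compact K /\ forall u, `|u| <= 1 -> K (A u).
Proof.
move=> [_ _ A_cpt]; exists (closure (A @` [set u : V | `|u| <= 1])); split.
  rewrite -precompactE; apply: A_cpt.
  by exists 1; split => // x x1 u /= u1; exact: le_trans (ltW x1).
by move=> u u1; apply: subset_closure; exists u.
Qed.

Lemma compact_operator_bounded (R : realType) (V : normedModType R)
    (D : set V) (A : V -> V) : compact_operator D A ->
  exists2 C, 0 < C & forall u, `|A u| <= C * `|u|.
Proof.
move=> A_comp; have [K [cK AK]] := compact_operator_unit_ball A_comp.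
have [_ A_lin _] := A_comp; have [C [_ KC]] := compact_bounded cK.
(* The bound on [K] holds for every constant strictly above [C], a real of unknown sign; this one is
   also positive. *)
have C0 : 0 < `|C| + 1 by rewrite ltr_wpDl.
exists (`|C| + 1) => // u.
have A0 : A 0 = 0.
  by apply: (addrI (A 0)); have := A_lin 1 0 0; rewrite !scale1r !addr0 => <-.
have [->|u0] := eqVneq u 0; first by rewrite A0 !normr0 mulr0.
have nu : 0 < `|u| by rewrite normr_gt0.
have := A_lin (`|u|^-1) u 0; rewrite A0 !addr0 => AZ.
have : `|A (`|u|^-1 *: u)| <= `|C| + 1.
  apply: KC; first by rewrite (le_lt_trans (ler_norm C))// ltrDl.
  by apply: AK; rewrite normrZ gtr0_norm ?invr_gt0// mulVf ?gt_eqF.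
by rewrite AZ normrZ gtr0_norm ?invr_gt0// mulrC ler_pdivrMr.
Qed.

(** * Inner product geometry *)

Section Inner_product.
Context {R : realType} {X : Type} (H : rkhs R X).
Implicit Types (u v w : H) (W : set H).

Local Notation "<< u , v >>" := (ip H u v).

Lemma ipC u v : << u, v >> = << v, u >>.
Proof. by rewrite hermC expr0 mul1r. Qed.

Lemma ipDl u v w : << u + v, w >> = << u, w >> + << v, w >>.
Proof. exact: linearDl. Qed.

Lemma ipNl u v : << - u, v >> = - << u, v >>.
Proof. exact: linearNl. Qed.

Lemma ipZl c u v : << c *: u, v >> = c * << u, v >>.
Proof. exact: linearZl_LR. Qed.

Lemma ipBl u v w : << u - v, w >> = << u, w >> - << v, w >>.
Proof. by rewrite ipDl ipNl. Qed.

Lemma ipDr u v w : << u, v + w >> = << u, v >> + << u, w >>.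
Proof. by rewrite ipC ipDl !(ipC u). Qed.

Lemma ipNr u v : << u, - v >> = - << u, v >>.
Proof. by rewrite ipC ipNl ipC. Qed.

Lemma ipBr u v w : << u, v - w >> = << u, v >> - << u, w >>.
Proof. by rewrite ipDr ipNr. Qed.

Lemma ipZr c u v : << u, c *: v >> = c * << u, v >>.
Proof. by rewrite ipC ipZl ipC. Qed.

Lemma norm_ipD u v : `|u + v| ^+ 2 = `|u| ^+ 2 + 2 * << u, v >> + `|v| ^+ 2.
Proof. by rewrite !norm_ip !ipDl !ipDr (ipC v u); ring. Qed.

(** Cauchy-Schwarz, read off from the triangle inequality by expanding both squares. *)
Lemma ip_le_norm u v : << u, v >> <= `|u| * `|v|.
Proof.
have : `|u + v| ^+ 2 <= (`|u| + `|v|) ^+ 2.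
  by rewrite ler_sqr ?nnegrE ?addr_ge0// ler_normD.
by rewrite norm_ipD; lra.
Qed.

Definition orthogonal_to W u := forall w, W w -> << u, w >> = 0.

Lemma norm_le_orthogonal u v : << u, v >> = 0 -> `|u| <= `|u + v|.
Proof.
move=> uv; rewrite -ler_sqr ?nnegrE// norm_ipD uv mulr0 addr0.
by rewrite lerDl sqr_ge0.
Qed.

(** [orth_proj] is a choice with default 0, so its defining property holds only where a projection
    exists. *)
Definition projectable W :=
  forall h, exists p, W p /\ orthogonal_to W (h - p).

Lemma orth_projP W h : projectable W ->
  W (orth_proj W h) /\ orthogonal_to W (h - orth_proj W h).
Proof. by move=> /(_ h) pW; exact: (xgetPex 0 pW). Qed.

Lemma norm_orth_proj_le W h : projectable W -> `|orth_proj W h| <= `|h|.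
Proof.
move=> /orth_projP-/(_ h)[Wp /(_ _ Wp) op].
rewrite -[X in _ <= `|X|](subrK (orth_proj W h) h).
by rewrite addrC; apply: norm_le_orthogonal; rewrite ipC.
Qed.

Lemma norm_orth_proj_compl_le W h : projectable W ->
  `|h - orth_proj W h| <= `|h|.
Proof.
move=> /orth_projP-/(_ h)[Wp /(_ _ Wp) op].
by rewrite -[X in _ <= `|X|](subrK (orth_proj W h) h); exact: norm_le_orthogonal.
Qed.

(** Pythagoras: with [p] the projection, [h - p] is orthogonal to both [p] and [v], hence to
    [p - v]. *)
Lemma orth_proj_closest W h v : projectable W -> W v ->
  `|h - orth_proj W h| <= `|h - v|.
Proof.
move=> /orth_projP-/(_ h)[Wp op] Wv.
rewrite [in leRHS](_ : h - v = h - orth_proj W h + (orth_proj W h - v)).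
  by apply: norm_le_orthogonal; rewrite ipBr !op// subrr.
by rewrite addrA subrK.
Qed.

(** * Spans of the first vectors of a sequence *)

Lemma span_firstS (G : nat -> H) M u : span_first G M.+1 u <->
  exists v c, span_first G M v /\ u = v + c *: G M.
Proof.
split=> [[c _ <-]|[v [b [[c _ <-] ->]]]].
  exists (\sum_(i < M) c i *: G i), (c M); split; first by exists c.
  by rewrite big_ord_recr.
exists (fun i => if i == M then b else c i) => //.
rewrite big_ord_recr/= eqxx; congr (_ + _).
by apply: eq_bigr => i _; rewrite ltn_eqF.
Qed.

Lemma span_first_nondecreasing (G : nat -> H) :
  {homo span_first G : m n / (m <= n)%N >-> m `<=` n}.
Proof.
apply: homo_leq => [A|B A C AB BC|M u Mu]; first exact: subset_refl.
  exact: subset_trans AB BC.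
by apply/span_firstS; exists u, 0; rewrite scale0r addr0.
Qed.

(* Gram-Schmidt: [q] is the component of [G M] orthogonal to the first [M]
   vectors; when [q = 0] the coefficient below is the junk value [0], which is
   then also the right one. *)
Lemma span_first_projectable (G : nat -> H) M : projectable (span_first G M).
Proof.
elim: M => [h|M IH h].
  exists 0; split; first by exists (fun=> 0) => //; rewrite big_ord0.
  by move=> w [c _ <-]; rewrite big_ord0 ipC -(scale0r (0 : H)) ipZl mul0r.
have [p' [q [Wp' op' GE]]] : exists p' q,
    [/\ span_first G M p', orthogonal_to (span_first G M) q & G M = p' + q].
  have [p' [Wp' op']] := IH (G M).
  by exists p', (G M - p'); split => //; rewrite addrC subrK.
have [p [Wp op]] := IH h; pose b := << h, q >> / << q, q >>.
have WZ v c : span_first G M v -> span_first G M (c *: v).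
  move=> [d _ <-]; exists (fun i => c * d i) => //.
  by rewrite scaler_sumr; apply: eq_bigr => i _; rewrite scalerA.
have WD v w : span_first G M v -> span_first G M w -> span_first G M (v + w).
  move=> [d _ <-] [e _ <-]; exists (fun i => d i + e i) => //.
  by rewrite -big_split; apply: eq_bigr => i _; rewrite scalerDl.
exists (p + b *: q); split.
  (* Since [q = G M - p'], the candidate is [(p - b *: p') + b *: G M]. *)
  apply/span_firstS; exists (p + (- b) *: p'), b; split.
    exact: WD (WZ _ _ _).
  by rewrite -addrA GE scaleNr scalerDr addKr.
move=> _ /span_firstS[v [c [Wv ->]]].
have hq : << h, q >> = b * << q, q >>.
  have [q0|q0] := eqVneq << q, q >> 0; last by rewrite divfK.
  rewrite q0 mulr0; suff -> : q = 0 by rewrite -(scale0r (0 : H)) ipZr mul0r.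
  by apply/eqP; rewrite -normr_eq0 -sqrf_eq0 norm_ip q0.
rewrite GE scalerDr addrA ipDr opprD addrA ipBl op ?ipZl; last first.
  exact: WD (WZ _ _ _).
rewrite op'; last exact: WD (WZ _ _ _).
by rewrite ipZr !ipBl (ipC p) op'// ipZl hq; ring.
Qed.

(** * Increasing subspaces with dense union *)

Section Exhausting_subspaces.
Context (V : nat -> set H).
Hypothesis V_mono : {homo V : m n / (m <= n)%N >-> m `<=` n}.
Hypothesis V_dense : dense (\bigcup_(M in [set: nat]) V M).

Lemma dense_approx u (e : R) : 0 < e -> exists M v, V M v /\ `|u - v| < e.
Proof.
move=> e0; have /V_dense/(_ (ball_open _ _))[v [uv [M _ Vv]]] : ball u e !=set0.
  by exists u; exact: ballxx.
by exists M, v; split => //; move: uv; rewrite -ball_normE.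
Qed.

(* An almost minimiser [v] of [J] can be taken in some [V M]; comparing [J] at
   [v] and [v + e *: g] bounds [phi g]. *)
Lemma functional_small_orthogonal (phi : H -> R) (C e : R) :
  (forall c u v, phi (c *: u + v) = c * phi u + phi v) ->
  (forall u, `|phi u| <= C * `|u|) -> 0 < e ->
  \forall M \near \oo, forall g, orthogonal_to (V M) g -> `|g| <= 1 ->
    phi g <= e.
Proof.
move=> phiP phiC e0; pose J u := `|u| ^+ 2 - 2 * phi u.
have infJ : has_inf (range J).
  split; first by exists (J 0), 0.
  (* Completing the square: [J u] is at least [(|u| - C)^2 - C^2]. *)
  exists (- C ^+ 2) => _ [u _ <-]; rewrite /J.
  have := phiC u; rewrite ler_norml => /andP[_ ?].
  by have := sqr_ge0 (`|u| - C); rewrite sqrrB; lra.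
have e2 : 0 < e ^+ 2 / 2 by rewrite divr_gt0 ?exprn_gt0.
have [_ [u _ <-] Ju] := inf_adherent e2 infJ.
(* When [|u - v| <= 1], [J v - J u] is at most [D * |u - v|]; the summand 1 absorbs the quadratic
   term [|u - v|^2]. *)
pose D := 2 * `|u| + 1 + 2 * `|C|.
have D0 : 0 < D by rewrite /D; have := normr_ge0 u; have := normr_ge0 C; lra.
have d0 : 0 < Num.min 1 (e ^+ 2 / 2 / D) by rewrite lt_min ltr01 divr_gt0.
have [M [v [Vv uv]]] := dense_approx u d0.
have {uv} [uv1 uvD] : `|u - v| <= 1 /\ `|u - v| * D <= e ^+ 2 / 2.
  by move: uv; rewrite lt_min ltr_pdivlMr// => /andP[/ltW ? /ltW].
have phiB : phi u - phi v = phi (u - v).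
  by rewrite [u - v]addrC -(scaleN1r v) phiP mulN1r addrC.
have Jv : J v <= J u + e ^+ 2 / 2.
  move: uvD; rewrite /J /D => uvD.
  have := phiC (u - v); rewrite ler_norml -phiB => /andP[_ h1].
  have h2 : C * `|u - v| <= `|C| * `|u - v| by rewrite ler_wpM2r// ler_norm.
  have h3 : `|v| <= `|u| + `|u - v|.
    by rewrite -{1}(subKr u v) ler_normB.
  have h4 : `|v| ^+ 2 <= (`|u| + `|u - v|) ^+ 2.
    by rewrite ler_sqr ?nnegrE ?addr_ge0.
  have h5 : `|u - v| * `|u - v| <= `|u - v| by rewrite ler_piMl.
  by lra.
exists M => // N MN g og g1.
have gv : << g, v >> = 0 by apply: og; exact: V_mono Vv.
have Jg : inf (range J) <= J (e *: g + v).
  by apply: ge_inf; [exact: infJ.2|exists (e *: g + v)].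
have : `|g| ^+ 2 <= 1 by rewrite expr_le1.
move: Jg; rewrite /J phiP norm_ipD ipZl gv normrZ exprMn (gtr0_norm e0).
move: Ju Jv; rewrite /J => Ju Jv Jg gg.
(* As [g] is orthogonal to [v], [J (e *: g + v)] equals [J v + e^2 |g|^2 - 2 e phi g], while
   [J v < inf J + e^2]. *)
have : 2 * e * phi g <= 2 * e * e by nra.
by rewrite ler_pM2l// mulr_gt0.
Qed.

Lemma compact_small_orthogonal (D : set H) (A : H -> H) (e : R) :
  compact_operator D A -> 0 < e ->
  \forall M \near \oo, forall g, orthogonal_to (V M) g -> `|g| <= 1 ->
    `|A g| <= e.
Proof.
move=> A_comp e0.
have [K [cK AK]] := compact_operator_unit_ball A_comp.
have [C C0 A_bd] := compact_operator_bounded A_comp.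
have [_ A_lin _] := A_comp.
have : \forall M \near \oo, K `<=` [set y | forall g,
    orthogonal_to (V M) g -> `|g| <= 1 -> << A g, y >> <= e ^+ 2].
  (* It suffices to treat points [z] near a fixed [y], with [M] large; compactness makes the
     threshold on [M] uniform over [K]. *)
  move/compact_near_coveringP : cK; apply => y Ky.
  have e2 : 0 < e ^+ 2 / 2 by rewrite divr_gt0 ?exprn_gt0.
  have phi_small := @functional_small_orthogonal (fun u => << A u, y >>)
    (C * `|y|) _ _ _ e2.
  have {phi_small} : \forall M \near \oo, forall g, orthogonal_to (V M) g ->
      `|g| <= 1 -> << A g, y >> <= e ^+ 2 / 2.
    apply: phi_small => [c u v|u]; first by rewrite A_lin ipDl ipZl.
    rewrite ler_norml lerNl -ipNr mulrAC; apply/andP; split.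
      rewrite -[X in _ * X]normrN; apply: le_trans (ip_le_norm _ _) _.
      by rewrite ler_wpM2r.
    by apply: le_trans (ip_le_norm _ _) _; rewrite ler_wpM2r.
  move=> phi_small; near=> z M.
  have phi_M : forall g, orthogonal_to (V M) g -> `|g| <= 1 ->
      << A g, y >> <= e ^+ 2 / 2 by near: M.
  move=> g og g1; rewrite -(subrK y z) ipDr; have h1 := phi_M g og g1.
  (* Since [|A g| <= C], moving from [y] to [z] costs at most the remaining [e ^+ 2 / 2]. *)
  have h2 : `|z - y| <= e ^+ 2 / 2 / C.
    by near: z; apply: cvgr_distC_le => //; rewrite divr_gt0.
  have h3 : `|A g| * `|z - y| <= C * (e ^+ 2 / 2 / C).
    apply: ler_pM => //; apply: le_trans (A_bd g) _.
    by rewrite ler_piMr// ltW.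
  have := ip_le_norm (A g) (z - y).
  by move: h3; rewrite (mulrC C) divfK ?gt_eqF//; lra.
apply: filterS => M small g og g1.
rewrite -ler_sqr ?nnegrE ?(ltW e0)// norm_ip.
by apply: small => //; exact: AK.
Unshelve. all: by end_near. Qed.

Hypothesis V_proj : forall M, projectable (V M).

(** A point [v] of some [V N] close to [y] is also close to every [z] near [y]. For [M >= N] the
    projection of [z] is at least as close to [z] as [v] is, and compactness removes the dependence
    on [y]. *)
Lemma compact_orth_proj_uniform (K : set H) (e : R) : compact K -> 0 < e ->
  \forall M \near \oo, K `<=` [set y | `|y - orth_proj (V M) y| <= e].
Proof.
move=> /compact_near_coveringP cK e0; apply: cK => y Ky.
have e2 : 0 < e / 2 by rewrite divr_gt0.
have [N [v [Vv yv]]] := dense_approx y e2.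
near=> z M => /=.
have VMv : V M v by apply: V_mono Vv; near: M; exists N.
apply: le_trans (orth_proj_closest _ _ VMv) _ => //.
rewrite (splitr e) -(subrKA y) (le_trans (ler_normD _ _))// lerD// 1?ltW//.
Unshelve. all: by end_near. Qed.

End Exhausting_subspaces.

End Inner_product.

(** * Convergence to 0 in operator norm *)

Lemma op_norm_cvg0 (R : realType) (V : normedModType R) (B : nat -> V -> V) :
  (forall e : R, 0 < e ->
    \forall M \near \oo, forall h, `|h| <= 1 -> `|B M h| <= e) ->
  op_norm (B M) @[M --> \oo] --> 0%E.
Proof.
move=> B_small; have B_ge0 M : (0 <= op_norm (B M))%E.
  apply: le_trans (ereal_sup_ubound _); last by exists 0 => //=; rewrite normr0.
  by rewrite lee_fin.
have B_le (e : R) : 0 < e -> \forall M \near \oo, (op_norm (B M) <= e%:E)%E.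
  move=> /B_small; apply: filterS => M Be.
  by apply: ub_ereal_sup => _ [h h1 <-]; rewrite lee_fin; exact: Be.
(* Eventual finiteness lets the extended-real limit be computed in [R]. *)
have B_fin : \forall M \near \oo, op_norm (B M) \is a fin_num.
  apply: filterS (B_le 1 ltr01) => M B1.
  by rewrite ge0_fin_numE//; exact: le_lt_trans B1 (ltry _).
apply/fine_cvgP; split => //; apply/cvgr0Pnorm_le => e e0.
near=> M => /=.
have BM : op_norm (B M) \is a fin_num by near: M.
rewrite ger0_norm ?fine_ge0// -lee_fin fineK//.
by near: M; exact: B_le.
Unshelve. all: by end_near. Qed.

(** * Norm convergence of the compressions of [A] *)

Theorem theorem2 (R : realType) (n : nat) (H : rkhs R 'cV[R]_n)
    (a : R) (f : 'cV[R]_n -> 'cV[R]_n)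
    (T : nat -> R) (gamma : nat -> R -> 'cV[R]_n) (Gamma : nat -> H)
    (hH : is_bargmann_fock H)
    (ha : `|a| < 1)
    (hA : compact_operator (liouville_dom H f a) (liouville H f a))
    (hT : forall i : nat, 0 < T i)
    (hgamma : forall i : nat, trajectory f (T i) (gamma i))
    (hGamma : forall i : nat, is_occupation_kernel (T i) (gamma i) (Gamma i))
    (hdense : dense (\bigcup_(M in [set: nat]) span_first Gamma M)) :
  op_norm (fun h : H =>
      orth_proj (span_first Gamma M)
        (liouville H f a (orth_proj (span_first Gamma M) h))
      - liouville H f a h)
    @[M --> \oo] --> 0%E.
Proof.
set A := liouville H f a in hA *.
have V_mono := @span_first_nondecreasing _ _ H Gamma.
have V_proj M : projectable (span_first Gamma M).
  exact: span_first_projectable.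
have [_ A_lin _] := hA; have [K [cK AK]] := compact_operator_unit_ball hA.
apply: op_norm_cvg0 => e e0; have e2 : 0 < e / 2 by rewrite divr_gt0.
near=> M.
have small_compl : K `<=` [set y |
    `|y - orth_proj (span_first Gamma M) y| <= e / 2].
  by near: M; exact: compact_orth_proj_uniform.
have small_orth : forall g, orthogonal_to (span_first Gamma M) g ->
    `|g| <= 1 -> `|A g| <= e / 2.
  by near: M; exact: compact_small_orthogonal hA e2.
move=> h h1; set P := orth_proj (span_first Gamma M) in small_compl *.
have AB : A (h - P h) = A h - A (P h).
  by rewrite addrC -(scaleN1r (P h)) A_lin scaleN1r addrC.
have -> : P (A (P h)) - A h = - (A (P h) - P (A (P h))) - A (h - P h).
  by rewrite AB !opprB subrKA.
rewrite (splitr e) (le_trans (ler_normB _ _))// normrN lerD//.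
  (* [P h] stays in the unit ball, so [A (P h)] lies in [K]. *)
  by apply/small_compl/AK; exact: le_trans (norm_orth_proj_le _ _) h1.
apply: small_orth; first exact: (orth_projP _ _).2.
exact: le_trans (norm_orth_proj_compl_le _ _) h1.
Unshelve. all: by end_near. Qed.
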